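(* Let $0<a<b$ and let $F:\mathbb{R}^d\to\mathbb{R}^d$ be a continuously differentiable vector field with $F(\omega^* )=0$ and such that every eigenvalue of the Jacobian $\mathbf{J}_F(\omega^* )$ lies in $[ia,ib]\cup[-ia,-ib]$. Let $\eta>0$ and define $$F^{\mathrm{real}}(\omega)=\tfrac1\eta\big(F(\omega-\eta F(\omega))-F(\omega)\big).$$ Set $\sqrt{\alpha}=\frac{2}{a+b}$ and $\sqrt{\beta}=\frac{b-a}{b+a}$. Then the iteration $$\omega_{t+1}=\omega_t-\alpha F^{\mathrm{real}}(\omega_t)+\beta(\omega_t-\omega_{t-1})$$ converges locally to $\omega^*$ at the linear rate $O\big((1-\frac{2a}{a+b})^t\big)$.
   Context: For $z,w\in\mathbb{C}$, $[z,w]$ denotes the closed segment joining $z$ and $w$ in the complex plane. Convention on rates: for $0<\rho<1$, a two-step iteration $\omega_{t+1}=V(\omega_t,\omega_{t-1})$ with $V(\omega^*,\omega^* )=\omega^*$ ''converges locally to $\omega^*$ at the linear rate $O(\rho^t)$'' if for every $\epsilon>0$ with $\rho+\epsilon<1$ there exist a neighbourhood $U$ of $\omega^*$ and a constant $C$ such that for all $\omega_0,\omega_1\in U$ and all $t\ge 0$, $\|\omega_t-\omega^*\|\le C(\rho+\epsilon)^t$. (This is implied by the Jacobian of the augmented map $(\omega,\omega')\mapsto(V(\omega,\omega'),\omega)$ at $(\omega^*,\omega^* )$ having spectral radius at most $\rho$.) *)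

(* Defs.v *)
From HB Require Import structures.
From mathcomp Require Import all_boot all_order all_algebra.
From mathcomp Require Import all_classical all_reals all_analysis.
From mathcomp Require Export complex.

Set Implicit Arguments.
Unset Strict Implicit.
Unset Printing Implicit Defensive.

Import Order.TTheory GRing.Theory Num.Theory.
Import numFieldNormedType.Exports.

Local Open Scope classical_set_scope.
Local Open Scope ring_scope.
Local Open Scope complex_scope.

Definition csegment (R : realType) (z w : R[i]) : set R[i] :=
  [set x | exists t : R, 0 <= t <= 1 /\ x = (1 - t)%:C * z + t%:C * w].

(* The library's norm on 'rV[R]_d is the sup norm; this is the Euclidean one. *)
Definition enorm (R : realType) (d : nat) (v : 'rV[R]_d) : R :=
  Num.sqrt (\sum_(i < d) v ord0 i ^+ 2).

Definition C1_field (R : realType) (d : nat) (F : 'rV[R]_d -> 'rV[R]_d) : Prop :=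
  (forall x, differentiable F x) /\ continuous (fun x => 'J F x).

(* Vectors are rows, so 'J F x is the transpose of the usual Jacobian matrix;
   the two have the same eigenvalues.  A real matrix has to be mapped to R[i]
   for [eigenvalue] to range over its complex eigenvalues. *)
Definition complex_eigenvalue (R : realType) (d : nat) (A : 'M[R]_d)
    (z : R[i]) : Prop :=
  eigenvalue (map_mx (real_complex R) A) z.

Definition two_step_orbit (T : Type) (V : T -> T -> T) (w : nat -> T) : Prop :=
  forall t, w t.+2 = V (w t.+1) (w t).

(* The first two conjuncts make explicit the conditions under which a rate of
   local convergence is defined. *)
Definition converges_locally_at_rate (R : realType) (d : nat)
    (V : 'rV[R]_d -> 'rV[R]_d -> 'rV[R]_d) (ws : 'rV[R]_d) (rho : R) : Prop :=
  [/\ 0 < rho < 1,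
      V ws ws = ws &
      forall eps : R, 0 < eps -> rho + eps < 1 ->
        exists (U : set 'rV[R]_d) (C : R), nbhs ws U /\
          forall w : nat -> 'rV[R]_d, two_step_orbit V w ->
            U (w 0%N) -> U (w 1%N) ->
            forall t : nat, enorm (w t - ws) <= C * (rho + eps) ^+ t].

Definition Freal (R : realType) (d : nat) (eta : R) (F : 'rV[R]_d -> 'rV[R]_d)
    (w : 'rV[R]_d) : 'rV[R]_d :=
  eta^-1 *: (F (w - eta *: F w) - F w).

(* Polyak's heavy-ball step for G: [w] is the current iterate, [w'] the
   previous one. *)
Definition momentum_step (R : realType) (d : nat) (alpha beta : R)
    (G : 'rV[R]_d -> 'rV[R]_d) (w w' : 'rV[R]_d) : 'rV[R]_d :=
  w - alpha *: G w + beta *: (w - w').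

(* Main.v *)
(* Since F vanishes at ws, the differential of Freal there is - J^2, whose
   eigenvalues lie in [a^2, b^2].  An eigenvalue z of the iteration linearized
   on pairs (current, previous) is therefore a root of
   z^2 - (1 + beta - alpha m) z + beta with m in [a^2, b^2].  For the given
   alpha and beta the discriminant is nonpositive, so both roots have modulus
   sqrt beta = 1 - 2 a / (a + b).  By Cayley-Hamilton the powers of a matrix
   grow at most like r^k for every r beyond its spectral radius, and a
   first-order perturbation of the linear recursion loses arbitrarily little
   of that rate. *)
Require Import Defs.
From HB Require Import structures.
From mathcomp Require Import all_boot all_order all_algebra.
From mathcomp Require Import all_classical all_reals all_analysis.
From mathcomp Require Import ring lra.

Set Implicit Arguments.
Unset Strict Implicit.
Unset Printing Implicit Defensive.

Import Order.TTheory GRing.Theory Num.Theory.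
Import numFieldNormedType.Exports.

Local Open Scope classical_set_scope.
Local Open Scope ring_scope.
Local Open Scope complex_scope.

(** * Growth of matrix powers *)

(** Absorbing one factor [A - z%:M] into [B] shortens the list, so the induction needs a general
    [B]. Since [B A^(k+1) = B (A - z) A^k + z B A^k], each root adds a scalar recursion of ratio at
    most [rho], driven by a term [K r^k]. *)
Lemma mx_power_bound_annihilated (C : numClosedFieldType) (n : nat)
    (A : 'M[C]_n.+1) (rho r : C) (s : seq C) (B : 'M[C]_n.+1) :
  0 <= rho -> rho < r -> (forall z, z \in s -> `|z| <= rho) ->
  B * \prod_(z <- s) (A - z%:M) = 0 ->
  exists2 K : C, 0 <= K & forall k i j, `|(B * A ^+ k) i j| <= K * r ^+ k.
Proof.
move=> rho_ge0 rho_lt_r; have r_ge0 : 0 <= r by exact: le_trans (ltW rho_lt_r).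
elim: s B => [|z s IHs] B s_le.
  rewrite big_nil mulr1 => ->; exists 0 => // k i j.
  by rewrite mul0r mxE normr0 mul0r.
rewrite big_cons mulrA => /IHs[z' z's|K K_ge0 Kbound].
  by apply: s_le; rewrite inE z's orbT.
have rB_gt0 : 0 < r - rho by rewrite subr_gt0.
pose S := \sum_i \sum_j `|B i j|.
have S_ge0 : 0 <= S by apply: sumr_ge0 => i _; apply: sumr_ge0.
(* [S] covers [k = 0], and [x = K / (r - rho)] solves [K + rho * x = r * x]. *)
exists (K / (r - rho) + S); first by rewrite addr_ge0// divr_ge0// ltW.
elim=> [|k IHk] i j.
  rewrite !expr0 !mulr1; apply: (@le_trans _ _ S); last first.
    by rewrite lerDr divr_ge0// ltW.
  rewrite /S (bigD1 i)//= (bigD1 j)//= -addrA lerDl.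
  by rewrite addr_ge0 ?sumr_ge0// => i' _; apply: sumr_ge0.
have -> : B * A ^+ k.+1 = B * (A - z%:M) * A ^+ k + z *: (B * A ^+ k).
  by rewrite mulrBr mulrBl exprS mulrA -mulmxE mul_mx_scalar -scalemxAl subrK.
rewrite mxE [X in _ + X]mxE; apply: (le_trans (ler_normD _ _)).
have zBA_le :
    `|z * (B * A ^+ k) i j| <= rho * ((K / (r - rho) + S) * r ^+ k).
  by rewrite normrM ler_pM// s_le// inE eqxx.
apply: (le_trans (lerD (Kbound k i j) zBA_le)).
rewrite mulrA -mulrDl exprS mulrA ler_wpM2r ?exprn_ge0//.
rewrite [leRHS]mulrC -lerBrDr -mulrBl mulrDr mulrCA divff ?gt_eqF// mulr1.
by rewrite lerDl mulr_ge0// ltW.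
Qed.

(** The characteristic polynomial splits into linear factors at the eigenvalues and vanishes at [A]
    by Cayley-Hamilton, so [B = 1] fits the previous lemma. *)
Lemma mx_power_bound_complex (C : numClosedFieldType) (n : nat)
    (A : 'M[C]_n) (rho r : C) :
  0 <= rho -> rho < r -> (forall z, eigenvalue A z -> `|z| <= rho) ->
  exists2 K : C, 0 <= K & forall k i j, `|(A ^+ k) i j| <= K * r ^+ k.
Proof.
case: n A => [|n] A rho_ge0 rho_lt_r eig_le; first by exists 0 => // k [].
have [s sE] := closed_field_poly_normal (char_poly A).
move: sE; rewrite (monicP (char_poly_monic A)) scale1r => sE.
have [z zs||K K_ge0 Kbound] :=
    @mx_power_bound_annihilated C n A rho r s 1 rho_ge0 rho_lt_r.
- by apply: eig_le; rewrite eigenvalue_root_char sE root_prod_XsubC.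
- rewrite mul1r -(Cayley_Hamilton A) sE rmorph_prod; apply: eq_bigr => z _.
  by rewrite rmorphB/= horner_mx_X horner_mx_C.
by exists K => // k i j; rewrite -[A ^+ k]mul1r.
Qed.

Lemma mx_power_bound (R : rcfType) (n : nat) (A : 'M[R]_n) (rho r : R) :
  0 <= rho -> rho < r ->
  (forall z : R[i], eigenvalue (map_mx (real_complex R) A) z ->
    `|z| <= rho%:C) ->
  exists2 K : R, 0 <= K & forall k i j, `|(A ^+ k) i j| <= K * r ^+ k.
Proof.
move=> rho_ge0 rho_lt_r eig_le.
have [||K K_ge0 Kbound] :=
    @mx_power_bound_complex R[i] n _ rho%:C r%:C _ _ eig_le.
- by rewrite lecR.
- by rewrite ltcR.
have KE : K = (complex.Re K)%:C by rewrite (RRe_real (ger0_real K_ge0)).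
exists (complex.Re K); first by rewrite -lecR -KE.
move=> k i j; move: (Kbound k i j).
rewrite -rmorphXn -rmorphXn/= mxE normc_def/= KE -rmorphM/=.
by rewrite expr0n addr0 sqrtr_sqr lecR.
Qed.


(** * Sup-norm estimates *)

Lemma mx_norm_coord_le (R : realType) (m n : nat) (A : 'M[R]_(m, n)) i j :
  `|A i j| <= `|A|.
Proof.
rewrite [leRHS]/Num.norm/= mx_normrE.
exact: (le_bigmax _ (fun ij => `|A ij.1 ij.2|) (i, j)).
Qed.

Lemma mx_norm_le (R : realType) (m n : nat) (A : 'M[R]_(m, n)) (c : R) :
  0 <= c -> (forall i j, `|A i j| <= c) -> `|A| <= c.
Proof.
move=> c_ge0 Ac; rewrite [leLHS]/Num.norm/= mx_normrE.
by apply/bigmax_leP; split=> // ij _; exact: Ac.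
Qed.

Lemma norm_mulmx_le (R : realType) (m n : nat) (v : 'rV[R]_n)
    (B : 'M[R]_(n, m)) (c : R) :
  0 <= c -> (forall i j, `|B i j| <= c) -> `|v *m B| <= n%:R * c * `|v|.
Proof.
move=> c_ge0 Bc; apply: mx_norm_le => [|i j]; first by rewrite !mulr_ge0.
rewrite mxE; apply: (le_trans (ler_norm_sum _ _ _)).
apply: (@le_trans _ _ (\sum_(k < n) c * `|v|)).
  apply: ler_sum => k _; rewrite normrM mulrC ler_pM//.
  exact: mx_norm_coord_le.
by rewrite sumr_const card_ord -mulrA mulr_natl.
Qed.

Lemma norm_row_mxl_le (R : realType) (n m : nat) (u : 'rV[R]_n) (v : 'rV[R]_m) :
  `|u| <= `|row_mx u v|.
Proof.
apply: mx_norm_le => // i j.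
by rewrite -(row_mxEl u v); exact: mx_norm_coord_le.
Qed.

Lemma norm_row_mxr_le (R : realType) (n m : nat) (u : 'rV[R]_n) (v : 'rV[R]_m) :
  `|v| <= `|row_mx u v|.
Proof.
apply: mx_norm_le => // i j.
by rewrite -(row_mxEr u v); exact: mx_norm_coord_le.
Qed.

Lemma norm_row_mx_le (R : realType) (n m : nat) (u : 'rV[R]_n) (v : 'rV[R]_m)
    (c : R) :
  `|u| <= c -> `|v| <= c -> `|row_mx u v| <= c.
Proof.
move=> uc vc; have c_ge0 := le_trans (normr_ge0 _) uc.
apply: mx_norm_le => // i j.
case: (splitP j) => k jk.
  have -> : j = lshift m k by exact: val_inj.
  by rewrite row_mxEl; exact: le_trans (mx_norm_coord_le _ _ _) uc.
have -> : j = rshift n k by exact: val_inj.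
by rewrite row_mxEr; exact: le_trans (mx_norm_coord_le _ _ _) vc.
Qed.

Lemma enorm_le (R : realType) (d : nat) (v : 'rV[R]_d) :
  enorm v <= Num.sqrt d%:R * `|v|.
Proof.
rewrite -[X in _ * X](ger0_norm (normr_ge0 v)) -sqrtr_sqr -sqrtrM//.
apply: ler_wsqrtr.
apply: (@le_trans _ _ (\sum_(i < d) `|v| ^+ 2)).
  apply: ler_sum => i _; rewrite -real_normK ?num_real//.
  by rewrite lerXn2r ?nnegrE//; exact: mx_norm_coord_le.
by rewrite sumr_const card_ord mulr_natl.
Qed.

(** * Geometric decay under a small perturbation *)

(** The error made at one step is carried on by powers of [M], so it raises the rate by at most
    [C * delta]. As the resulting rate is at most 1, the orbit never leaves the radius [Delta] where
    the error estimate is available. *)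
Lemma perturbed_linear_decay (R : realType) (n : nat) (M : 'M[R]_n)
    (C r delta Delta : R) (e : nat -> 'rV[R]_n) :
  0 <= C -> 0 <= r -> 0 <= delta -> r + C * delta <= 1 ->
  (forall k (v : 'rV[R]_n), `|v *m M ^+ k| <= C * r ^+ k * `|v|) ->
  (forall t, `|e t| <= Delta -> `|e t.+1 - e t *m M| <= delta * `|e t|) ->
  C * `|e 0%N| <= Delta ->
  forall t, `|e t| <= C * (r + C * delta) ^+ t * `|e 0%N|.
Proof.
move=> C_ge0 r_ge0 delta_ge0 rC_le1 Mpow estep e0_le t.
have q_ge0 : 0 <= r + C * delta by rewrite addr_ge0 ?mulr_ge0.
set q := r + C * delta in rC_le1 q_ge0 *.
(* Carrying all the images [e t *m M ^+ k] along makes the induction close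
   without adapting the norm to M. *)
suff main k : `|e t *m M ^+ k| <= C * r ^+ k * (q ^+ t * `|e 0%N|).
  by have := main 0%N; rewrite !expr0 mulmx1 mulr1 mulrA.
elim: t k => [|t IHt] k; first by rewrite expr0 mul1r.
have et_le : `|e t| <= C * (q ^+ t * `|e 0%N|).
  by have := IHt 0%N; rewrite !expr0 mulmx1 mulr1.
have /estep step_le : `|e t| <= Delta.
  apply: le_trans et_le _; apply: le_trans e0_le; rewrite ler_wpM2l//.
  by rewrite ler_piMl// exprn_ile1.
have -> : e t.+1 *m M ^+ k = (e t.+1 - e t *m M) *m M ^+ k + e t *m M ^+ k.+1.
  by rewrite mulmxBl exprS -mulmxE mulmxA subrK.
apply: (le_trans (ler_normD _ _)).
apply: (le_trans (lerD (Mpow _ _) (IHt _))).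
have Cr_ge0 : 0 <= C * r ^+ k by rewrite mulr_ge0 ?exprn_ge0.
apply: (@le_trans _ _ (C * r ^+ k * (delta * (C * (q ^+ t * `|e 0%N|)))
    + C * r ^+ k.+1 * (q ^+ t * `|e 0%N|))).
  rewrite lerD2r ler_wpM2l//; apply: (le_trans step_le).
  by rewrite ler_wpM2l.
by rewrite le_eqVlt; apply/orP; left; apply/eqP; rewrite !exprS /q; ring.
Qed.

(** * Spectrum of the linearized iteration *)

(** The vector [y (A - s)] is killed by [A + s], so it is zero or an eigenvector for [- s]. *)
Lemma eigenvalue_sqr (F : fieldType) (n : nat) (A : 'M[F]_n) (s : F)
    (y : 'rV[F]_n) :
  y != 0 -> y *m A *m A = s ^+ 2 *: y -> eigenvalue A s \/ eigenvalue A (- s).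
Proof.
move=> y_neq0 yAA; have [yA|yA] := eqVneq (y *m A) (s *: y).
  by left; apply/eigenvalueP; exists y.
right; apply/eigenvalueP; exists (y *m A - s *: y); last by rewrite subr_eq0.
by rewrite mulmxBl yAA -scalemxAl scalerBr !scaleNr scalerA -expr2 opprK addrC.
Qed.

(** Once [c = 2 x], the real part of the equation reads [x^2 + y^2 = beta]. Off the real axis the
    imaginary part forces [c = 2 x]; on it, the equation gives [(c - 2 x)^2 = c^2 - 4 beta <= 0]. *)
Lemma quadratic_root_norm (R : rcfType) (z : R[i]) (c beta : R) :
  c ^+ 2 <= 4 * beta -> z ^+ 2 - c%:C * z + beta%:C = 0 ->
  `|z| = (Num.sqrt beta)%:C.
Proof.
case: z => x y c2 /eqP; rewrite expr2 eq_complex; simpc.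
move=> /andP[/eqP re /eqP im].
congr (Num.sqrt _)%:C.
move: re im => /= re im; suff cE : c = 2 * x by rewrite cE in re; lra.
have [y0|y0] := eqVneq y 0; last by apply: (mulfI y0); lra.
have : (c - 2 * x) ^+ 2 <= 0 by rewrite y0 in re; lra.
by rewrite exprn_even_le0//= subr_eq0 => /eqP.
Qed.

(* Acts on row vectors as (u, v) |-> ((1 + beta) u + alpha u J^2 - beta v, u):
   the linearized iteration on pairs (current, previous), the differential of
   Freal at ws being - J^2. *)
Definition heavy_ball_mx (K : pzRingType) (d : nat) (alpha beta : K)
    (J : 'M[K]_d) : 'M[K]_(d + d) :=
  block_mx ((1 + beta)%:M + alpha *: (J *m J)) 1%:M (- beta%:M) 0.

Lemma mul_heavy_ball_mx (K : comPzRingType) (d : nat) (alpha beta : K)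
    (J : 'M[K]_d) (u v : 'rV[K]_d) :
  row_mx u v *m heavy_ball_mx alpha beta J =
  row_mx ((1 + beta) *: u + alpha *: (u *m J *m J) - beta *: v) u.
Proof.
rewrite mul_row_block mulmx1 mulmx0 addr0 mulmxDr mulmxN !mul_mx_scalar.
by rewrite -scalemxAr mulmxA.
Qed.

(* The eigenvectors of the companion matrix are (z y, y), where y is an
   eigenvector of J^2. *)
Lemma eigenvalue_heavy_ball_mx (F : closedFieldType) (d : nat)
    (alpha beta z : F) (J : 'M[F]_d) :
  alpha != 0 -> beta != 0 -> eigenvalue (heavy_ball_mx alpha beta J) z ->
  exists2 s : F, eigenvalue J s &
    z ^+ 2 - (1 + beta + alpha * s ^+ 2) * z + beta = 0.
Proof.
move=> alpha_neq0 beta_neq0 /eigenvalueP[v vE v_neq0].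
move: vE v_neq0; rewrite -(hsubmxK v); set x := lsubmx v; set y := rsubmx v.
rewrite mul_heavy_ball_mx scale_row_mx => /eq_row_mx[xE yE] v_neq0.
have y_neq0 : y != 0.
  by apply: contraNneq v_neq0 => y0; rewrite yE y0 scaler0 row_mx0.
(* If [z = 0], then [x = z y] vanishes and the first component reduces to [beta y = 0]. *)
have z_neq0 : z != 0.
  apply: contraNneq y_neq0 => z0; move/eqP: xE.
  rewrite yE z0 !scale0r !mul0mx !scaler0 !add0r oppr_eq0 scaler_eq0.
  by rewrite (negbTE beta_neq0).
have az_neq0 : alpha * z != 0 by rewrite mulf_neq0.
(* The quadratic equation solved for the eigenvalue of [J^2]. *)
pose nu := (z ^+ 2 - (1 + beta) * z + beta) / (alpha * z).
have yJJ : y *m J *m J = nu *: y.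
  move: xE; rewrite yE -!scalemxAl !scalerA -expr2 => xE.
  apply: (scalerI az_neq0); rewrite scalerA [_ * nu]mulrC divfK//.
  rewrite scalerDl scalerBl -xE.
  by rewrite [X in X - _ - _]addrC [X in X + _]addrAC addrK subrK.
(* A square root of [nu], obtained as a root of [X^2 - nu]. *)
have [s sE] :=
  solve_monicpoly (fun k => if k is 0 then nu else 0) (isT : (0 < 2)%N).
move: sE; rewrite !big_ord_recl big_ord0 !mul0r !addr0 expr0 mulr1 => sE.
have quad : z ^+ 2 - (1 + beta + alpha * s ^+ 2) * z + beta = 0.
  rewrite sE mulrDl (mulrAC alpha) /nu [_ * (_ / _)]mulrC divfK//; ring.
rewrite -sE in yJJ.
have [s_eig|s_eig] := eigenvalue_sqr y_neq0 yJJ; first by exists s.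
by exists (- s) => //; rewrite sqrrN.
Qed.

Lemma csegment_imaginary (R : realType) (a b : R) (z : R[i]) :
  a <= b ->
  (csegment ('i%C * a%:C) ('i%C * b%:C)
    `|` csegment (- ('i%C * a%:C)) (- ('i%C * b%:C))) z ->
  exists2 t : R, a <= t <= b & z ^+ 2 = (- t ^+ 2)%:C.
Proof.
move=> ab []/= [t [/andP[t0 t1] ->]].
all: exists ((1 - t) * a + t * b); first by apply/andP; split; nra.
all: apply/eqP; rewrite expr2 eq_complex; simpc; rewrite ?eqxx ?andbT//=.
by apply/eqP; ring.
Qed.

Lemma heavy_ball_mx_spectrum (R : realType) (d : nat) (a b alpha beta : R)
    (J : 'M[R]_d) (z : R[i]) :
  0 < a -> a < b ->
  (forall z : R[i], complex_eigenvalue J z ->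
    (csegment ('i%C * a%:C) ('i%C * b%:C)
     `|` csegment (- ('i%C * a%:C)) (- ('i%C * b%:C))) z) ->
  Num.sqrt alpha = 2 / (a + b) -> Num.sqrt beta = (b - a) / (b + a) ->
  complex_eigenvalue (heavy_ball_mx alpha beta J) z ->
  `|z| = (Num.sqrt beta)%:C.
Proof.
move=> a_gt0 a_lt_b spec sqa sqb.
have ab_gt0 : 0 < a + b by lra.
(* [Num.sqrt] is zero on negative numbers, so a positive root forces a positive argument, which
   squaring then recovers. *)
have alpha_gt0 : 0 < alpha by rewrite -sqrtr_gt0 sqa divr_gt0.
have beta_gt0 : 0 < beta by rewrite -sqrtr_gt0 sqb divr_gt0// ?subr_gt0// addrC.
have alphaE : alpha = (2 / (a + b)) ^+ 2 by rewrite -sqa sqr_sqrtr// ltW.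
have betaE : beta = ((b - a) / (a + b)) ^+ 2.
  by rewrite [a + b]addrC -sqb sqr_sqrtr// ltW.
have -> : complex_eigenvalue (heavy_ball_mx alpha beta J) z =
    eigenvalue (heavy_ball_mx alpha%:C beta%:C (map_mx (real_complex R) J)) z.
  rewrite /complex_eigenvalue /heavy_ball_mx map_block_mx map_mxD map_mxZ.
  by rewrite map_mxM map_mxN !map_scalar_mx map_mx0 rmorphD !rmorph1.
move=> /eigenvalue_heavy_ball_mx[||s /spec s_seg].
- by rewrite fmorph_eq0 gt_eqF.
- by rewrite fmorph_eq0 gt_eqF.
have [t /andP[at_ tb] ->] := csegment_imaginary (ltW a_lt_b) s_seg.
rewrite -(rmorph1 (real_complex R)) -rmorphD -rmorphM -rmorphD => quad.
apply: (quadratic_root_norm _ quad).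
(* With q = sqrt beta and u = sqrt alpha * t, u ranges over [1 - q, 1 + q],
   which is exactly the range in which the quadratic has no two distinct real
   roots. *)
pose q := (b - a) / (a + b); pose u := 2 / (a + b) * t.
have q_ge0 : 0 <= q by apply: divr_ge0; lra.
have pE : 1 - q = 2 / (a + b) * a by rewrite /q; field; rewrite gt_eqF.
have rE : 1 + q = 2 / (a + b) * b by rewrite /q; field; rewrite gt_eqF.
have k_ge0 : 0 <= 2 / (a + b) by apply: divr_ge0; lra.
have p_ge0 : 0 <= 1 - q by rewrite pE; apply: mulr_ge0; lra.
have pu : 1 - q <= u by rewrite pE ler_wpM2l.
have ur : u <= 1 + q by rewrite rE ler_wpM2l.
have -> : 1 + beta + alpha * - t ^+ 2 = 1 + q ^+ 2 - u ^+ 2.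
  by rewrite alphaE betaE /q /u; ring.
have -> : 4 * beta = (2 * q) ^+ 2 by rewrite betaE /q; ring.
have u_ge0 : 0 <= u by exact: le_trans pu.
have r_ge0 : 0 <= 1 + q by exact: le_trans ur.
have lo : (1 - q) ^+ 2 <= u ^+ 2 by rewrite lerXn2r.
have hi : u ^+ 2 <= (1 + q) ^+ 2 by rewrite lerXn2r.
rewrite -ler_sqrt ?sqr_ge0// !sqrtr_sqr (ger0_norm (mulr_ge0 _ q_ge0))//.
by rewrite ler_norml; apply/andP; split; lra.
Qed.

(** * Linearization of the field at its zero *)

(** Because [F ws = 0], the inner map [w - eta F w] fixes [ws], so the chain rule only involves the
    differential [L] of [F] at [ws]: [eta^-1 (L (id - eta L) - L) = - L^2], in which [eta]
    cancels. *)
Lemma Freal_expansion (R : realType) (d : nat) (eta : R)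
    (F : 'rV[R]_d -> 'rV[R]_d) (ws : 'rV[R]_d) :
  0 < eta -> differentiable F ws -> F ws = 0 ->
  forall eps : R, 0 < eps -> \forall h \near (0 : 'rV[R]_d),
    `|Freal eta F (ws + h) + h *m 'J F ws *m 'J F ws| <= eps * `|h|.
Proof.
move=> eta_gt0 /differentiableP dF F0.
have FrealE : Freal eta F = eta^-1 *: (F \o (id - eta *: F) - F).
  by apply/funext => w; rewrite /Freal.
have dG : is_diff ws (Freal eta F)
    (eta^-1 *: ('d F ws \o (id - eta *: ('d F ws : 'rV[R]_d -> 'rV[R]_d))
      - ('d F ws : 'rV[R]_d -> 'rV[R]_d))).
  rewrite FrealE; apply: is_diffZ; apply: is_diffB.
  apply: is_diff_comp.
  by rewrite !fctE F0 scaler0 subr0.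
have JE (h : 'rV[R]_d) : h *m 'J F ws = 'd F ws h.
  by rewrite /jacobian mul_rV_lin1.
have /diff_locally/eqaddoP expand := @ex_diff _ _ _ _ _ _ _ dG.
move=> eps /expand; apply: filterS => h /=.
have Fws : Freal eta F ws = 0.
  by rewrite /Freal F0 scaler0 !subr0 F0 scaler0.
have -> : Freal eta F (ws + h) + h *m 'J F ws *m 'J F ws =
    (Freal eta F \o shift ws - (cst (Freal eta F ws) + 'd (Freal eta F) ws)) h.
  rewrite diff_val Fws !fctE/= add0r [h + ws]addrC; congr (_ + _).
  rewrite !JE (linearB ('d F ws)) (linearZ_LR ('d F ws)) addrAC subrr add0r.
  by rewrite scalerN opprK scalerA mulVf ?gt_eqF// scale1r.
by [].
Qed.

(** * Local convergence of the momentum iteration *)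

Unset Implicit Arguments.

Theorem proposition4 (R : realType) (d : nat) (a b : R)
    (F : 'rV[R]_d -> 'rV[R]_d) (ws : 'rV[R]_d) (eta alpha beta : R)
    (a_gt0 : 0 < a) (a_lt_b : a < b)
    (F_C1 : C1_field F) (F_ws : F ws = 0)
    (spec : forall z : R[i], complex_eigenvalue ('J F ws) z ->
       (csegment ('i%C * a%:C) ('i%C * b%:C)
        `|` csegment (- ('i%C * a%:C)) (- ('i%C * b%:C))) z)
    (eta_gt0 : 0 < eta)
    (sqrt_alpha : Num.sqrt alpha = 2 / (a + b))
    (sqrt_beta : Num.sqrt beta = (b - a) / (b + a)) :
  converges_locally_at_rate (momentum_step alpha beta (Freal eta F)) ws
    (1 - 2 * a / (a + b)).
Proof.
have ab_gt0 : 0 < a + b by lra.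
have rhoE : 1 - 2 * a / (a + b) = Num.sqrt beta.
  by rewrite sqrt_beta; field; rewrite !gt_eqF// addrC.
rewrite rhoE.
have rho_gt0 : 0 < Num.sqrt beta by rewrite sqrt_beta divr_gt0//; lra.
have rho_lt1 : Num.sqrt beta < 1.
  by rewrite sqrt_beta ltr_pdivrMr; lra.
have alpha_gt0 : 0 < alpha by rewrite -sqrtr_gt0 sqrt_alpha divr_gt0.
have G_ws : Freal eta F ws = 0.
  by rewrite /Freal F_ws scaler0 !subr0 F_ws scaler0.
split; first exact/andP.
  by rewrite /momentum_step G_ws scaler0 subrr scaler0 subr0 addr0.
move=> eps eps_gt0 rate_lt1.
set rho := Num.sqrt beta in rho_gt0 rho_lt1 rate_lt1 *.
pose M := heavy_ball_mx alpha beta ('J F ws).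
(* Half of [eps] pays for the growth of powers beyond the spectral radius, the other half for the
   nonlinearity, through [C * delta = eps / 2]. *)
have [||z z_eig|K K_ge0 Kbound] := @mx_power_bound R _ M rho (rho + eps / 2).
- exact: ltW.
- by rewrite ltrDl divr_gt0.
- have := heavy_ball_mx_spectrum a_gt0 a_lt_b spec sqrt_alpha sqrt_beta z_eig.
  by move=> ->.
(* The added 1 makes [C] positive in every case, so that division by it is allowed. *)
pose C := (d + d)%:R * K + 1.
have C_gt0 : 0 < C by rewrite ltr_wpDl// mulr_ge0.
have Mpow k (v : 'rV[R]_(d + d)) :
    `|v *m M ^+ k| <= C * (rho + eps / 2) ^+ k * `|v|.
  have q_ge0 : 0 <= (rho + eps / 2) ^+ k by rewrite exprn_ge0//; lra.
  apply: (le_trans (norm_mulmx_le v (mulr_ge0 K_ge0 q_ge0) (Kbound k))).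
  by rewrite ler_wpM2r// mulrA ler_wpM2r// lerDl.
pose delta := eps / 2 / C.
have delta_gt0 : 0 < delta by rewrite !divr_gt0.
have CdE : rho + eps / 2 + C * delta = rho + eps.
  by rewrite /delta; field; rewrite gt_eqF.
(* The iteration multiplies this remainder by [alpha], which turns the tolerance into [delta]. *)
have /(_ (delta / alpha)) := Freal_expansion eta_gt0 (F_C1.1 ws) F_ws.
rewrite divr_gt0// => /(_ isT) /nbhs_ballP[Delta/= Delta_gt0 near0].
(* Halving puts the closed ball of radius [D] inside the open ball of radius [Delta]. *)
pose D := Delta / 2.
have expand (h : 'rV[R]_d) : `|h| <= D ->
    `|Freal eta F (ws + h) + h *m 'J F ws *m 'J F ws| <= delta / alpha * `|h|.
  move=> hD; apply: near0; rewrite -ball_normE/= sub0r normrN.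
  by apply: (le_lt_trans hD); rewrite /D; lra.
have DC_gt0 : 0 < D / C by rewrite !divr_gt0.
(* The radius ensures [C * |e 0| <= D]. In the constant, [Num.sqrt d%:R] passes from sup to
   Euclidean norm, [C] comes from the decay estimate and [D / C] bounds [|e 0|]. *)
exists (ball ws (D / C)), (Num.sqrt d%:R * (C * (D / C))); split.
  exact: nbhsx_ballx.
move=> w w_orbit U0 U1 t.
(* With the later iterate first, [e 0] holds both initial points and [w t] is read off the second
   half of [e t], so the exponent is exactly [t]. *)
pose e t := row_mx (w t.+1 - ws) (w t - ws).
have e0_le : `|e 0%N| <= D / C.
  by apply: norm_row_mx_le; apply: ltW;
    [move: U1|move: U0]; rewrite -ball_normE/= distrC.
have e_step k : `|e k| <= D -> `|e k.+1 - e k *m M| <= delta * `|e k|.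
  move=> ekD; set h := w k.+1 - ws.
  have h_le : `|h| <= `|e k| by exact: norm_row_mxl_le.
  (* The linear parts cancel and the second component is reproduced exactly; only the remainder of
     [Freal] survives. *)
  have -> : e k.+1 - e k *m M =
      row_mx (- alpha *: (Freal eta F (ws + h) + h *m 'J F ws *m 'J F ws)) 0.
    rewrite /e mul_heavy_ball_mx opp_row_mx add_row_mx subrr; congr row_mx.
    rewrite w_orbit /momentum_step -/h.
    have -> : ws + h = w k.+1 by rewrite addrC subrK.
    have -> : w k.+1 - w k = h - (w k - ws) by rewrite opprB addrA subrK.
    apply/rowP => i; rewrite !mxE; ring.
  apply: norm_row_mx_le; last by rewrite normr0 mulr_ge0// ltW.
  rewrite normrZ normrN gtr0_norm//.
  apply: (@le_trans _ _ (alpha * (delta / alpha * `|h|))).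
    by rewrite ler_pM2l// expand// (le_trans h_le).
  by rewrite mulrA mulrCA divff ?gt_eqF// mulr1 ler_pM2l.
have := @perturbed_linear_decay R _ M C (rho + eps / 2) delta D e.
rewrite CdE => /(_ (ltW C_gt0) _ (ltW delta_gt0) (ltW rate_lt1) Mpow e_step).
move=> decay.
apply: (le_trans (enorm_le _)); rewrite -mulrA ler_wpM2l//.
apply: (le_trans (norm_row_mxr_le (w t.+1 - ws) _)).
apply: (le_trans (decay _ _ t)).
- lra.
- by rewrite mulrC -ler_pdivlMr.
- rewrite mulrAC ler_wpM2r ?ler_pM2l//.
  by rewrite exprn_ge0//; lra.
Qed.
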